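(* For every integer $n\ge 1$, let $M(n,K_4)$ be the largest cardinality of a set of Hamiltonian paths in $K_n$ such that the union of any two distinct members of the set contains a $4$-clique (a subgraph isomorphic to $K_4$). Then $$2^{\lfloor n/4\rfloor}\le M(n,K_4)\le (n+1)^2\left(\frac32\right)^{n-1}.$$
   Context: $K_n$ is the complete graph on the vertex set $\{1,\dots,n\}$. Hamiltonian paths of $K_n$ are undirected and are regarded as (labelled) subgraphs of $K_n$; the union of two paths is the graph whose edge set is the union of their edge sets. *)

(* Defs.v *)
From HB Require Import structures.
From mathcomp Require Import all_boot all_order all_algebra.

Set Implicit Arguments.
Unset Strict Implicit.
Unset Printing Implicit Defensive.

(* A spanning subgraph of the complete graph on a finite vertex type T is     *)
(* represented by its set of edges, an edge being the unordered pair          *)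
(* [set x; y] of its two distinct endpoints.                                  *)

Section Graphs.
Variable T : finType.
Implicit Types (s : seq T) (E : {set {set T}}) (k : nat).

Definition path_edges s : {set {set T}} :=
  [set [set p.1; p.2] | p in zip s (behead s)].

(* A Hamiltonian path is identified with its edge set, so an enumeration of   *)
(* the vertices and its reversal give one and the same path.  On one vertex   *)
(* the only Hamiltonian path is the one without edges.                        *)
Definition hamiltonian_path E : bool :=
  [exists s : #|T|.-tuple T, uniq s && (E == path_edges s)].

Definition contains_clique k E : bool :=
  [exists S : {set T}, (#|S| == k) &&
    [forall x in S, forall y in S, (x != y) ==> ([set x; y] \in E)]].

End Graphs.

Definition clique_union_family (n k : nat) (F : {set {set {set 'I_n}}}) : bool :=
  [forall P in F, hamiltonian_path P] &&
  [forall P in F, forall Q in F, (P != Q) ==> contains_clique k (P :|: Q)].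

(* The maximum is attained: the empty family is always admissible.           *)
Definition M (n k : nat) : nat :=
  \max_(F : {set {set {set 'I_n}}} | clique_union_family k F) #|F|.

(* Main.v *)
Require Import Defs.
From mathcomp Require Import all_boot all_order all_algebra.
From mathcomp Require Import zify.
Import Order.TTheory GRing.Theory Num.Theory.

Set Implicit Arguments.
Unset Strict Implicit.
Unset Printing Implicit Defensive.

(** The upper bound comes from colourings.  A graph that contains [K_4] has no
    proper colouring with three colours, whereas a Hamiltonian path on [n]
    vertices has exactly [3 * 2 ^ n.-1] of them: choose the colour of the first
    vertex freely, then each further colour among the two that differ from the
    preceding one.  If the union of two paths contains [K_4], no colouring is
    proper for both, so the sets of proper 3-colourings of the members of an
    admissible family are pairwise disjoint subsets of the [3 ^ n] colourings.
    Hence the family has at most [(3/2) ^ n.-1] members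
    ([card_clique_union_family], for cliques of any order), which is even
    smaller than the bound claimed.

    For the lower bound, the complement in [K_4] of the path [0 1 2 3] is again
    a path, [2 0 3 1].  Cut [0, ..., n-1] into [n %/ 4] blocks of four
    consecutive vertices, traverse the blocks in their natural order, and
    traverse each block in one of these two ways.  Two different sequences of
    choices differ in some block, which then spans a [K_4] in the union
    ([block_path_clique]).  The same colouring argument shows that they give
    different paths: a single path never contains [K_4]. *)

(** * Edges of a path *)

Section PathEdges.
Variable T : finType.
Implicit Types (s : seq T) (E : {set {set T}}).

Lemma path_edges_cons x y s :
  path_edges [:: x, y & s] = [set x; y] |: path_edges (y :: s).
Proof.
apply/setP=> e; rewrite in_setU1; apply/imsetP/orP.
- case=> p; rewrite /= in_cons => /orP[/eqP-> -> | ps ->]; first by left.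
  by right; apply/imsetP; exists p.
case=> [/eqP-> | /imsetP[p ps ->]].
- by exists (x, y); rewrite //= in_cons eqxx.
by exists p; rewrite //= in_cons ps orbT.
Qed.

Lemma path_edges_short s : size s <= 1 -> path_edges s = set0.
Proof.
by case: s => [|x [|y s]] // _; apply/setP=> e; rewrite inE;
  apply/negP=> /imsetP[].
Qed.

Lemma mem_path_edges x0 s i : i.+1 < size s ->
  [set nth x0 s i; nth x0 s i.+1] \in path_edges s.
Proof.
elim: s i => [|x [|y s] IHs] //= [|i] lti; rewrite path_edges_cons.
  by rewrite setU11.
by rewrite in_setU1 IHs ?orbT.
Qed.

Lemma hamiltonian_path_edges s :
  size s = #|T| -> uniq s -> hamiltonian_path (path_edges s).
Proof.
move=> /eqP szs Us; apply/existsP; exists (Tuple szs).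
by rewrite /= Us eqxx.
Qed.

End PathEdges.

(** * Proper colourings *)

Section Colourings.
Variables (T : finType) (C : finType).
Implicit Types (f : {ffun T -> C}) (E : {set {set T}}) (s : seq T).

Definition proper_colouring E f : bool :=
  [forall x, forall y, ([set x; y] \in E) ==> (f x != f y)].

Lemma proper_colouringP E f :
  reflect (forall x y, [set x; y] \in E -> f x != f y) (proper_colouring E f).
Proof.
apply: (iffP forallP) => [fE x y xyE | fE x].
  by have /forallP/(_ y)/implyP := fE x; apply.
by apply/forallP=> y; apply/implyP; apply: fE.
Qed.

Lemma proper_colouringU E1 E2 f :
  proper_colouring E1 f -> proper_colouring E2 f ->
  proper_colouring (E1 :|: E2) f.
Proof.
move=> /proper_colouringP f1 /proper_colouringP f2.
by apply/proper_colouringP=> x y; rewrite in_setU => /orP[/f1 | /f2].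
Qed.

(** Pigeonhole: a proper colouring is injective on a clique. *)
Lemma clique_not_colourable k E f :
  #|C| < k -> contains_clique k E -> ~~ proper_colouring E f.
Proof.
move=> ltCk /existsP[S /andP[/eqP cardS cliqueS]].
apply/negP=> /proper_colouringP fE.
suff finj : {in S &, injective f}.
  by move: ltCk; rewrite -cardS -(card_in_imset finj) ltnNge max_card.
move=> x y xS yS fxy; apply/eqP/negPn/negP=> neq_xy.
move/forall_inP/(_ x xS)/forall_inP/(_ y yS)/implyP/(_ neq_xy): cliqueS.
by move/fE; rewrite fxy eqxx.
Qed.

Lemma proper_colouring_path s f :
  sorted (fun c d => c != d) (map f s) -> proper_colouring (path_edges s) f.
Proof.
move=> fs; apply/proper_colouringP.
elim: s fs => [|a [|b s] IHs] /=.
- by move=> _ x y; rewrite path_edges_short // inE.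
- by move=> _ x y; rewrite path_edges_short // inE.
case/andP=> fab fs x y; rewrite path_edges_cons in_setU1.
case/orP=> [/eqP exy | ]; last exact: IHs.
apply: contraNneq fab => fxy.
have: (a \in [set x; y]) && (b \in [set x; y]) by rewrite exy set21 set22.
rewrite !inE.
by case/andP=> /orP[] /eqP-> /orP[] /eqP->; rewrite ?fxy.
Qed.

End Colourings.

(** * Counting the proper colourings of a Hamiltonian path *)

(** [lift c] enumerates the colours that differ from [c], so the sequences of
    colours without two equal neighbours are parametrised by their first colour
    and one index in ['I_q] for each step. *)
Definition colour_walk q (c : 'I_q.+1) (t : seq 'I_q) : seq 'I_q.+1 :=
  c :: scanl (@lift q.+1) c t.

Lemma size_colour_walk q (c : 'I_q.+1) (t : seq 'I_q) :
  size (colour_walk c t) = (size t).+1.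
Proof. by rewrite /= size_scanl. Qed.

Lemma colour_walk_sorted q (c : 'I_q.+1) (t : seq 'I_q) :
  sorted (fun a b => a != b) (colour_walk c t).
Proof. by elim: t c => //= i t IHt c; rewrite neq_lift IHt. Qed.

Lemma colour_walk_inj q (c d : 'I_q.+1) (t u : seq 'I_q) :
  colour_walk c t = colour_walk d u -> c = d /\ t = u.
Proof.
elim: t c d u => [|i t IHt] c d [|j u] /eqP; rewrite /= !eqseq_cons ?andbF //.
  by rewrite andbT => /eqP.
case/and3P=> /eqP-> /eqP eq_i /eqP eq_w; split=> //.
have [_ ->] := IHt _ _ u (congr2 cons eq_i eq_w).
by rewrite (lift_inj eq_i).
Qed.

Lemma map_nth_index (T U : eqType) (x0 : U) (s : seq T) (cs : seq U) :
  uniq s -> size cs = size s -> [seq nth x0 cs (index x s) | x <- s] = cs.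
Proof.
move=> Us szcs; apply: (@eq_from_nth _ x0) => [|i]; rewrite size_map //.
move=> lti; case: s Us szcs lti => // y s Us szcs lti.
by rewrite (nth_map y) // index_uniq.
Qed.

Lemma card_proper_colouring (T : finType) (q : nat) (E : {set {set T}}) :
  0 < #|T| -> hamiltonian_path E ->
  q.+1 * q ^ #|T|.-1 <= #|[set f : {ffun T -> 'I_q.+1} | proper_colouring E f]|.
Proof.
move=> T_gt0 /existsP[s /andP[Us /eqP->]].
pose h (ct : 'I_q.+1 * #|T|.-1.-tuple 'I_q) : {ffun T -> 'I_q.+1} :=
  [ffun x => nth ct.1 (colour_walk ct.1 ct.2) (index x s)].
have hs ct : map (h ct) s = colour_walk ct.1 ct.2.
  rewrite -[RHS](@map_nth_index _ _ ct.1 s) //.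
    by apply: eq_map => x; rewrite ffunE.
  by rewrite size_colour_walk !size_tuple prednK.
have h_inj : injective h.
  move=> [c t] [d u] eq_h.
  have := hs (c, t); rewrite eq_h hs /= => /colour_walk_inj[-> eq_t].
  by congr (_, _); apply: val_inj.
have -> : q.+1 * q ^ #|T|.-1 = #|[set h ct | ct in [set: _]]|.
  by rewrite card_imset // cardsT card_prod card_tuple !card_ord.
apply/subset_leq_card/subsetP=> _ /imsetP[ct _ ->]; rewrite inE.
by apply: proper_colouring_path; rewrite hs colour_walk_sorted.
Qed.

(** Already two colours suffice for a path ([q = 1] in the count above). *)
Lemma hamiltonian_path_no_clique (T : finType) (k : nat) (E : {set {set T}}) :
  2 < k -> hamiltonian_path E -> ~~ contains_clique k E.
Proof.
move=> lt2k hamE; apply/negP=> cliqueE.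
have [T0 | T_gt0] := posnP #|T|.
  case/existsP: cliqueE => S /andP[/eqP cardS _].
  by have := max_card (mem S); rewrite cardS T0; case: k lt2k {cardS}.
have := card_proper_colouring 1 T_gt0 hamE; rewrite exp1n.
case/(leq_trans (ltn0Sn _))/card_gt0P=> f; rewrite inE.
by apply/negP/(clique_not_colourable _ _ cliqueE); rewrite card_ord.
Qed.

(** * The upper bound *)

(** Double counting of the pairs of a member and a proper colouring of it with
    [q.+1] colours: a colouring proper for two members would be proper for
    their union, which contains a clique with more than [q.+1] vertices. *)
Lemma card_clique_union_family (n q : nat) (F : {set {set {set 'I_n}}}) :
  0 < n -> clique_union_family q.+2 F -> #|F| * q ^ n.-1 <= q.+1 ^ n.-1.
Proof.
move=> n_gt0 /andP[/forall_inP hamF /forall_inP cliqueF].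
rewrite -(leq_pmul2l (ltn0Sn q)) mulnCA -expnS prednK //.
pose col := {ffun 'I_n -> 'I_q.+1}.
apply: (@leq_trans (\sum_(P in F) \sum_(f : col) proper_colouring P f)).
  rewrite -sum_nat_const; apply: leq_sum => P /hamF hamP.
  have := @card_proper_colouring _ q P; rewrite card_ord => /(_ n_gt0 hamP).
  by move/leq_trans; apply; rewrite -sum1dep_card big_mkcond.
rewrite exchange_big /=.
have <- : \sum_(f : col) 1 = q.+1 ^ n by rewrite sum1_card card_ffun !card_ord.
apply: leq_sum => f _.
rewrite -big_mkcondr sum1_card; apply/card_le1_eqP => Q P.
rewrite !unfold_in => /andP[QF fQ] /andP[PF fP].
apply/eqP/negPn/negP => neqPQ.
have /forall_inP/(_ Q QF)/implyP/(_ neqPQ) cliquePQ := cliqueF P PF.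
have ltq : #|'I_q.+1| < q.+2 by rewrite card_ord.
have /negP := clique_not_colourable f ltq cliquePQ.
by apply; apply: proper_colouringU.
Qed.

(** * The lower bound *)

(** The vertex at position [x] when the blocks selected by [t] are traversed in
    the order [2 0 3 1], and all other vertices in increasing order. *)
Definition block_vertex (t : bitseq) (x : nat) : nat :=
  if nth false t (x %/ 4) then x %/ 4 * 4 + nth 0 [:: 2; 0; 3; 1] (x %% 4)
  else x.

Lemma block_vertexE t j p : p < 4 ->
  block_vertex t (j * 4 + p) =
    j * 4 + (if nth false t j then nth 0 [:: 2; 0; 3; 1] p else p).
Proof.
move=> lt_p; rewrite /block_vertex divnMDl // modnMDl modn_small //.
by rewrite divn_small // addn0; case: ifP.
Qed.

Lemma block_vertex_inj t : injective (block_vertex t).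
Proof.
move=> x y; rewrite (divn_eq x 4) (divn_eq y 4).
have := ltn_pmod x (isT : 0 < 4); have := ltn_pmod y (isT : 0 < 4).
move: (x %/ 4) (x %% 4) (y %/ 4) (y %% 4) => i p j r ltr ltp.
rewrite !block_vertexE // => eq_v.
have pi_lt4 r' : nth 0 [:: 2; 0; 3; 1] r' < 4.
  by case: r' => [|[|[|[|r']]]] //=; rewrite nth_nil.
have eq_ij : i = j.
  by move: eq_v (pi_lt4 p) (pi_lt4 r); do 2!case: ifP => _; lia.
rewrite eq_ij in eq_v *; congr (_ + _); move/addnI: eq_v; case: ifP => // _.
by case: p ltp => [|[|[|[|p]]]] // _; case: r ltr => [|[|[|[|r]]]].
Qed.

Section BlockPaths.
Variable n : nat.
Implicit Types t : (n.+1 %/ 4).-tuple bool.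

Lemma block_vertex_bound t x : x < n.+1 -> block_vertex t x < n.+1.
Proof.
rewrite /block_vertex; case: ifP => // tx _.
have: x %/ 4 < n.+1 %/ 4.
  by rewrite ltnNge; apply: contraTN tx => ?; rewrite nth_default ?size_tuple.
have: x %% 4 < 4 by rewrite ltn_pmod.
by case: (x %% 4) => [|[|[|[|p]]]] //= _; lia.
Qed.

Definition block_path t : seq 'I_n.+1 :=
  [seq inord (block_vertex t x) | x <- iota 0 n.+1].

Lemma hamiltonian_block_path t : hamiltonian_path (path_edges (block_path t)).
Proof.
apply: hamiltonian_path_edges; first by rewrite size_map size_iota card_ord.
rewrite map_inj_in_uniq ?iota_uniq // => x y.
rewrite !mem_iota /= !add0n => ltx lty /(congr1 (@nat_of_ord _)).
by rewrite !inordK ?block_vertex_bound // => /block_vertex_inj.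
Qed.

Lemma mem_block_path t x : x < n ->
  [set inord (block_vertex t x); inord (block_vertex t x.+1)]
    \in path_edges (block_path t).
Proof.
move=> ltx; have := @mem_path_edges _ ord0 (block_path t) x.
rewrite size_map size_iota => /(_ ltx).
by rewrite !(nth_map 0) ?nth_iota ?size_iota // ltnW.
Qed.

(** A block traversed differently by [t] and [u] is the clique: the two
    traversals share no edge, so together they have all six pairs. *)
Lemma block_path_clique t u : t != u ->
  contains_clique 4 (path_edges (block_path t) :|: path_edges (block_path u)).
Proof.
move=> neq_tu.
have [j neq_j] : exists j : 'I_(n.+1 %/ 4), tnth t j != tnth u j.
  apply/existsP; apply: contraNT neq_tu => /existsPn eq_tu.
  by apply/eqP/eq_from_tnth => j; apply/eqP/negPn/eq_tu.
wlog [tj uj] : t u {neq_tu} neq_j / tnth t j = false /\ tnth u j = true.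
  move=> IH; case tj: (tnth t j) (neq_j); case uj: (tnth u j) => // _.
    by rewrite setUC; apply: IH; rewrite // eq_sym.
  exact: IH.
rewrite !(tnth_nth false) in tj uj.
have ltj := ltn_ord j.
pose v p : 'I_n.+1 := inord (j * 4 + p).
pose B := [set v p | p : 'I_4].
have v_inj : injective (fun p : 'I_4 => v p).
  move=> p r /(congr1 (@nat_of_ord _)); have := ltn_ord p; have := ltn_ord r => ltr ltp.
  by rewrite !inordK; [move/addnI/val_inj | lia | lia].
apply/existsP; exists B; rewrite card_imset // card_ord eqxx /=.
have et p : p < 3 -> [set v p; v p.+1] \in path_edges (block_path t).
  move=> ltp; have := @mem_block_path t (j * 4 + p).
  by rewrite -addnS !block_vertexE ?tj; [apply | | ]; lia.
pose w p := v (nth 0 [:: 2; 0; 3; 1] p).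
have eu p : p < 3 -> [set w p; w p.+1] \in path_edges (block_path u).
  move=> ltp; have := @mem_block_path u (j * 4 + p).
  by rewrite -addnS !block_vertexE ?uj; [apply | | ]; lia.
apply/forall_inP=> _ /imsetP[p _ ->]; apply/forall_inP=> _ /imsetP[r _ ->].
apply/implyP; rewrite (inj_eq v_inj).
wlog ltpr : p r / p < r.
  move=> IH neq_pr; case: (ltngtP p r) => [||/val_inj eq_pr].
  - by move/IH; apply.
  - by rewrite setUC => /IH; apply; rewrite eq_sym.
  - by rewrite eq_pr eqxx in neq_pr.
move=> _; rewrite in_setU; apply/orP.
(* The pairs 01, 12, 23 are edges of the path [0 1 2 3], and the pairs
   02, 03, 13 are edges of the path [2 0 3 1]. *)
case: p r ltpr => [[|[|[|[|p]]]] ltp] [[|[|[|[|r]]]] ltr] //= _.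
- by left; apply: (et 0).
- by right; rewrite setUC; apply: (eu 0).
- by right; apply: (eu 1).
- by left; apply: (et 1).
- by right; rewrite setUC; apply: (eu 2).
- by left; apply: (et 2).
Qed.

Lemma leq_exp2_clique_union : 2 ^ (n.+1 %/ 4) <= M n.+1 4.
Proof.
pose E t := path_edges (block_path t).
pose F := [set E t | t in [set: (n.+1 %/ 4).-tuple bool]].
have E_inj : injective E.
  move=> t u eq_E; apply/eqP; apply: contraT => /block_path_clique.
  rewrite -/(E t) -/(E u) eq_E setUid => cliqueE.
  by have := hamiltonian_path_no_clique (isT : 2 < 4) (hamiltonian_block_path u);
    rewrite cliqueE.
have -> : 2 ^ (n.+1 %/ 4) = #|F|.
  by rewrite card_imset // cardsT card_tuple card_bool.
apply: (@leq_bigmax_cond _ (@clique_union_family n.+1 4) (fun F => #|F|) F).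
apply/andP; split.
  by apply/forall_inP=> _ /imsetP[t _ ->]; apply: hamiltonian_block_path.
apply/forall_inP=> _ /imsetP[t _ ->]; apply/forall_inP=> _ /imsetP[u _ ->].
by apply/implyP; rewrite (inj_eq E_inj) => /block_path_clique.
Qed.

End BlockPaths.

Local Open Scope ring_scope.

Theorem proposition4 (n : nat) (hn : (1 <= n)%N) :
  (2 ^ (n %/ 4) <= M n 4)%N /\
  (M n 4)%:R <= (n + 1)%:R ^+ 2 * (3%:R / 2%:R) ^+ (n - 1) :> rat.
Proof.
split; first by case: n hn => // n _; apply: leq_exp2_clique_union.
have leM : (M n 4 * 2 ^ n.-1 <= 3 ^ n.-1)%N.
  rewrite -leq_divRL ?expn_gt0 //; apply/bigmax_leqP => F cliqueF.
  by rewrite leq_divRL ?expn_gt0 //; apply: card_clique_union_family.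
rewrite subn1; apply: (@le_trans _ _ ((3%:R / 2%:R) ^+ n.-1)).
  rewrite expr_div_n ler_pdivlMr ?exprn_gt0 ?ltr0n //.
  by rewrite -!natrX -natrM ler_nat.
by rewrite ler_peMl ?exprn_ge0 // -natrX ler1n expn_gt0 addn1.
Qed.
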